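(* Let $\alpha$ and $\beta$ be non-zero complex numbers. Assume that $m\alpha+n\beta=0$ for some relatively prime positive integers $m$ and $n$. Consider the equation $$( * )\qquad p(u)q(u)=p(u+\beta)q(u+\alpha),\qquad p,q\in\mathbb{C}[u].$$ For any generalized Dyck path $\pi=\big((x_0,y_0),(x_1,y_1),\ldots,(x_{m+n},y_{m+n})\big)\in \mathscr{D}(m,n)$ and any complex number $\lambda\in\mathbb{C}$, the pair of polynomials $$( ** )\qquad (p,q)=\left(P^{\pi,\lambda}_1,\, P^{\pi,\lambda}_2\right),\qquad P_\varepsilon^{\pi,\lambda}(u)=\prod_{i=1}^{m+n} \big(u-(\lambda+x_i\alpha+y_i\beta)\big)^{\delta_{\varepsilon,1}\delta_{x_i,x_{i-1}}+\delta_{\varepsilon,2}\delta_{y_i,y_{i-1}}},\quad \varepsilon\in\{1,2\},$$ is an irreducible solution to $( * )$. Conversely, any irreducible solution to $( * )$ has the form $( ** )$ for some unique $(\pi,\lambda)\in \mathscr{D}(m,n)\times\mathbb{C}$.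
   Context: Lattice paths: a finite non-negative lattice path with unit steps to the right and up is a sequence $\pi=\big((x_0,y_0),\ldots,(x_N,y_N)\big)$ with $(x_i,y_i)\in(\mathbb{Z}_{\ge 0})^2$ and $(x_{i+1},y_{i+1})\in\{(x_i+1,y_i),(x_i,y_i+1)\}$ for $i=0,\ldots,N-1$; $(x_0,y_0)$ is its starting point and $(x_N,y_N)$ its end point. A generalized Dyck path is such a lattice path with starting point $(0,0)$ such that $my_i\ge nx_i$ for all $i$, where $(m,n)$ is the end point. $\mathscr{D}(m,n)$ is the set of all generalized Dyck paths with end point $(m,n)$. Irreducible solutions: products of pairs are componentwise, $(f,g)(p,q)=(fp,gq)$ in the ring $\mathbb{C}[u]\times\mathbb{C}[u]$. The solution $(1,1)$ of $( * )$ is called trivial. A non-trivial solution $(p,q)$ to $( * )$ in which $p$ and $q$ are non-zero and monic is called irreducible if whenever $(p,q)=(p_1,q_1)(p_2,q_2)$, where $(p_i,q_i)\in\mathbb{C}[u]\times\mathbb{C}[u]$ solves $( * )$ for $i\in\{1,2\}$, either $p_1$ and $q_1$ are constant or $p_2$ and $q_2$ are constant. $\delta_{a,b}$ is the Kronecker delta. *)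

(* Defs.v *)
From mathcomp Require Import all_boot all_order all_algebra.
From mathcomp Require Import reals.
From mathcomp Require Import complex.

Set Implicit Arguments.
Unset Strict Implicit.
Unset Printing Implicit Defensive.

Import GRing.Theory.
Local Open Scope ring_scope.

(* A lattice path is the non-empty sequence of its points in nat * nat. *)
Notation point := (nat * nat)%type.

Definition unit_step : rel point :=
  fun v w => (w == (v.1.+1, v.2)) || (w == (v.1, v.2.+1)).

Definition lattice_path (pi : seq point) : bool :=
  (pi != [::]) && sorted unit_step pi.

(* The default values are irrelevant: lattice paths are non-empty. *)
Definition start_point (pi : seq point) : point := head (0%N, 0%N) pi.
Definition end_point (pi : seq point) : point := last (0%N, 0%N) pi.

Definition gen_Dyck_path (pi : seq point) : bool :=
  let: (m, n) := end_point pi in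
  [&& lattice_path pi, start_point pi == (0%N, 0%N)
    & all (fun v : point => m * v.2 >= n * v.1)%N pi].

Definition Dyck (m n : nat) : pred (seq point) :=
  [pred pi | gen_Dyck_path pi & end_point pi == (m, n)].

Definition kronecker (a b : nat) : nat := (a == b).

Section Solutions.

Variable R : realType.
Implicit Types (alpha beta lambda : R[i]) (p : {poly R[i]})
  (pq : {poly R[i]} * {poly R[i]}).

(* u |-> p (u + c) *)
Definition shift p (c : R[i]) : {poly R[i]} := p \Po ('X + c%:P).

Definition solution alpha beta pq : Prop :=
  pq.1 * pq.2 = shift pq.1 beta * shift pq.2 alpha.

Definition constant_poly p : Prop := exists c : R[i], p = c%:P.

(* Monic polynomials are non-zero.  The product pq1 * pq2 is the
   componentwise one of the product ring. *)
Definition irreducible_solution alpha beta pq : Prop :=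
  [/\ solution alpha beta pq,
      pq <> (1, 1),
      pq.1 \is monic /\ pq.2 \is monic
    & forall pq1 pq2 : {poly R[i]} * {poly R[i]},
        solution alpha beta pq1 -> solution alpha beta pq2 ->
        pq = pq1 * pq2 ->
        (constant_poly pq1.1 /\ constant_poly pq1.2) \/
        (constant_poly pq2.1 /\ constant_poly pq2.2)].

Definition path_poly alpha beta (m n : nat) (eps : nat) (pi : seq point)
    lambda : {poly R[i]} :=
  let x i := (nth (0%N, 0%N) pi i).1 in
  let y i := (nth (0%N, 0%N) pi i).2 in
  \prod_(1 <= i < (m + n).+1)
    ('X - (lambda + (x i)%:R * alpha + (y i)%:R * beta)%:P)
      ^+ (kronecker eps 1 * kronecker (x i) (x i.-1)
          + kronecker eps 2 * kronecker (y i) (y i.-1))%N.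

Definition path_pair alpha beta (m n : nat) (pi : seq point) lambda :
    {poly R[i]} * {poly R[i]} :=
  (path_poly alpha beta m n 1 pi lambda, path_poly alpha beta m n 2 pi lambda).

End Solutions.

(* Main.v *)
Require Import Defs.
From mathcomp Require Import all_boot all_order all_algebra.
From mathcomp Require Import reals.
From mathcomp Require Import complex.
From mathcomp Require Import zify.
From mathcomp Require Import ring.

(* Equation ( * ) says that, in the directed multigraph on the complex numbers
   with an edge z - beta -> z for each root z of p and an edge z - alpha -> z
   for each root z of q, every vertex has equal in- and out-degree.  As
   n (alpha - beta) = (m + n) alpha, the height of lambda + x alpha + y beta,
   namely m y - n x, is raised by m by an up step and lowered by n by a right
   step, so both steps move its residue modulo m + n by m.  Start at a vertex
   lambda of minimal height and go right whenever the graph allows it, up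
   otherwise: at each step one sits at the lowest vertex of its residue class,
   hence the walk stays above height 0 and closes up after exactly m + n steps.
   So every non-constant solution is divisible by a path pair.  Comparing
   degrees, path pairs are irreducible; dividing out, irreducible solutions are
   path pairs.  A Dyck path visits each residue once, so it is the greedy walk
   of its own pair, which gives uniqueness. *)

Set Implicit Arguments.
Unset Strict Implicit.
Unset Printing Implicit Defensive.

Import Order.TTheory GRing.Theory Num.Theory.
Local Open Scope ring_scope.

(** * Dyck paths described point by point *)

Notation pt := (nth (0%N, 0%N)).

Lemma unit_step_height (v w : nat * nat) :
  unit_step v w -> (w.1 + w.2 = (v.1 + v.2).+1)%N.
Proof. by case/orP=> /eqP ->; rewrite /= ?addSn ?addnS. Qed.

(** Every step raises the coordinate sum by one, so the end point forces the number of points. *)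
Lemma DyckP (m n : nat) (pi : seq (nat * nat)) :
  reflect [/\ size pi = (m + n).+1, pt pi 0 = (0%N, 0%N), pt pi (m + n) = (m, n),
              forall i, (i < m + n)%N -> unit_step (pt pi i) (pt pi i.+1)
            & forall i, (i <= m + n)%N -> (n * (pt pi i).1 <= m * (pt pi i).2)%N]
          (pi \in Dyck m n).
Proof.
apply: (iffP idP).
  rewrite inE /= => /andP[+ /eqP endpi]; rewrite /gen_Dyck_path endpi.
  case/and3P=> /andP[pi_neq0 /(sortedP (0%N, 0%N)) stepP] /eqP startpi.
  move/(all_nthP (0%N, 0%N)) => above.
  have size_gt0 : (0 < size pi)%N by rewrite lt0n size_eq0.
  have pt0 : pt pi 0 = (0%N, 0%N) by rewrite nth0.
  have sumE i : (i < size pi)%N -> ((pt pi i).1 + (pt pi i).2 = i)%N.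
    elim: i => [|i IHi] i_lt; first by rewrite pt0.
    by rewrite (unit_step_height (stepP _ i_lt)) IHi // ltnW.
  have ptN : pt pi (size pi).-1 = (m, n) by rewrite nth_last.
  have sizeE : size pi = (m + n).+1.
    by rewrite -[in LHS](prednK size_gt0) -(sumE (size pi).-1) ?ptN // prednK.
  split=> // [|i i_lt|i i_le].
  - by rewrite -ptN sizeE.
  - by apply: stepP; rewrite sizeE.
  - by apply: above; rewrite sizeE ltnS.
case=> sizeE pt0 ptN stepP above.
have endE : end_point pi = (m, n) by rewrite /end_point -nth_last sizeE.
rewrite inE /= /gen_Dyck_path endE eqxx andbT; apply/and3P; split.
- apply/andP; split; first by rewrite -size_eq0 sizeE.
  by apply/(sortedP (0%N, 0%N)) => i; rewrite sizeE ltnS; apply: stepP.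
- by rewrite /start_point -nth0 pt0.
- by apply/(all_nthP (0%N, 0%N)) => i; rewrite sizeE ltnS; apply: above.
Qed.

Lemma Dyck_height (m n : nat) (pi : seq (nat * nat)) (i : nat) :
  pi \in Dyck m n -> (i <= m + n)%N -> ((pt pi i).1 + (pt pi i).2 = i)%N.
Proof.
case/DyckP=> _ pt0 _ stepP _; elim: i => [|i IHi] i_le; first by rewrite pt0.
by rewrite (unit_step_height (stepP _ i_le)) IHi // ltnW.
Qed.

(** The order on [R[i]] is partial, comparing only numbers with equal imaginary part, so maximal
    elements replace a maximum. *)
Lemma exists_maximal (d : Order.disp_t) (T : porderType d) (I : eqType)
    (f : I -> T) (s : seq I) :
  s != [::] -> exists2 x, x \in s & forall y, y \in s -> ~~ (f x < f y)%O.
Proof.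
elim: s => // x s IHs _; have [->|/IHs[y ys ymax]] := eqVneq s [::].
  by exists x; rewrite ?mem_head // => y; rewrite inE => /eqP->; rewrite ltxx.
have [ltyx|nltyx] := boolP (f y < f x)%O.
  exists x; rewrite ?mem_head // => z; rewrite inE => /predU1P[->|zs].
    by rewrite ltxx.
  by apply: contra (ymax z zs); apply: lt_trans.
by exists y; rewrite ?inE ?ys ?orbT // => z /predU1P[->|/ymax].
Qed.

(** * The graph of a solution and its vertices *)

Section Solutions.

Variable R : realType.
Implicit Types (lambda : R[i]) (p q : {poly R[i]}) (v w : nat * nat).

Lemma shiftM p q (c : R[i]) : shift (p * q) c = shift p c * shift q c.
Proof. exact: comp_polyM. Qed.

Lemma root_shift p (c z : R[i]) : root (shift p c) z = root p (z + c).
Proof. by rewrite !rootE horner_comp hornerD hornerX hornerC. Qed.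

Lemma constant_polyM p q : p * q != 0 ->
  size (p * q) == 1%N <-> constant_poly p /\ constant_poly q.
Proof.
rewrite mulf_eq0 negb_or size_mul_eq1 => /andP[p_neq0 q_neq0].
split=> [/andP[/size_poly1P[a _ ->] /size_poly1P[b _ ->]]|[[a pE] [b qE]]].
  by split; [exists a | exists b].
by move: p_neq0 q_neq0; rewrite pE qE !size_polyC !polyC_eq0 => -> ->.
Qed.

Lemma monic_constant p : p \is monic -> constant_poly p -> p = 1.
Proof. by move=> /monicP + [c pE]; rewrite pE lead_coefC => ->. Qed.

Variables (alpha beta : R[i]).

Lemma solutionM pq1 pq2 : solution alpha beta pq1 -> pq1.1 * pq1.2 != 0 ->
  solution alpha beta (pq1 * pq2) -> solution alpha beta pq2.
Proof.
move=> sol1 neq0; rewrite /solution /= !shiftM mulrACA.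
rewrite [X in _ = X]mulrACA -sol1.
exact: mulfI.
Qed.

(** The right side of the equation lists the edges leaving [z], the left side those entering it. *)
Lemma solution_succ p q (z : R[i]) : solution alpha beta (p, q) ->
  root (p * q) z = root p (z + beta) || root q (z + alpha).
Proof. by move=> sol; rewrite sol rootM !root_shift. Qed.

(** An edge entering [z] leaves [z - alpha] or [z - beta], which by the equation is then itself a
    root. *)
Lemma solution_pred p q (z : R[i]) : solution alpha beta (p, q) -> root (p * q) z ->
  root q z && root (p * q) (z - alpha) || root p z && root (p * q) (z - beta).
Proof.
move=> sol; rewrite rootM !(solution_succ _ sol) !subrK.
by case/orP=> ->; rewrite /= !orbT.
Qed.

Definition vertex lambda v : R[i] := lambda + v.1%:R * alpha + v.2%:R * beta.

Lemma vertex_right lambda (x y : nat) :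
  vertex lambda (x.+1, y) = vertex lambda (x, y) + alpha.
Proof. by rewrite /vertex /= -natr1; ring. Qed.

Lemma vertex_up lambda (x y : nat) :
  vertex lambda (x, y.+1) = vertex lambda (x, y) + beta.
Proof. by rewrite /vertex /= -natr1; ring. Qed.

Lemma vertex00 lambda : vertex lambda (0%N, 0%N) = lambda.
Proof. by rewrite /vertex /= !mul0r !addr0. Qed.

(** Adding [alpha - beta] trades an up step for a right step. *)
Lemma vertex_antidiag lambda (x y k : nat) : (k <= y)%N ->
  vertex lambda (x, y) + k%:R * (alpha - beta) = vertex lambda (x + k, y - k)%N.
Proof. by move=> le_ky; rewrite /vertex /= natrB // natrD; ring. Qed.

Definition greedy_step q lambda v :=
  if root q (vertex lambda v + alpha) then (v.1.+1, v.2) else (v.1, v.2.+1).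

(** * Path polynomials as products of linear factors over up and right steps *)

Section PathPolynomials.

Variables (m n : nat) (pi : seq (nat * nat)) (lambda : R[i]).

Let up (i : nat) := (pt pi i).1 == (pt pi i.-1).1.
Let right (i : nat) := (pt pi i).2 == (pt pi i.-1).2.

Lemma path_poly1E : path_poly alpha beta m n 1 pi lambda =
  \prod_(z <- [seq vertex lambda (pt pi i) | i <- index_iota 1 (m + n).+1 & up i])
     ('X - z%:P).
Proof.
rewrite big_map big_filter [RHS]big_mkcond; apply: eq_bigr => i _ /=.
by rewrite /kronecker /= mul1n mul0n addn0 -/(up i) /vertex; case: (up i).
Qed.

Lemma path_poly2E : path_poly alpha beta m n 2 pi lambda =
  \prod_(z <- [seq vertex lambda (pt pi i) | i <- index_iota 1 (m + n).+1 & right i])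
     ('X - z%:P).
Proof.
rewrite big_map big_filter [RHS]big_mkcond; apply: eq_bigr => i _ /=.
by rewrite /kronecker /= mul1n mul0n add0n -/(right i) /vertex; case: (right i).
Qed.

Hypothesis Dpi : pi \in Dyck m n.

Lemma Dyck_step (i : nat) : (0 < i <= m + n)%N -> up i = ~~ right i.
Proof.
case/DyckP: Dpi => _ _ _ stepP _; case: i => // i /= /stepP.
rewrite /up /right /=.
by case/orP=> /eqP-> /=; rewrite eqxx eqn_leq ltnn.
Qed.

Lemma path_polyM : path_poly alpha beta m n 1 pi lambda
    * path_poly alpha beta m n 2 pi lambda =
  \prod_(1 <= i < (m + n).+1) ('X - (vertex lambda (pt pi i))%:P).
Proof.
rewrite path_poly1E path_poly2E !big_map !big_filter.
rewrite [RHS](bigID up) /=; congr (_ * _).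
rewrite big_seq_cond [RHS]big_seq_cond; apply: eq_bigl => i.
case: (boolP (i \in _)) => //=; rewrite mem_index_iota ltnS.
by move/Dyck_step->; rewrite negbK.
Qed.

Lemma path_monic (eps : nat) : path_poly alpha beta m n eps pi lambda \is monic.
Proof.
by apply: monic_prod => i _; apply: monic_exp; apply: monicXsubC.
Qed.

End PathPolynomials.

Lemma shift_prod_XsubC (s : seq R[i]) (c : R[i]) :
  shift (\prod_(z <- s) ('X - z%:P)) c = \prod_(z <- s) ('X - (z - c)%:P).
Proof.
elim: s => [|z s IHs]; first by rewrite !big_nil /shift comp_polyC.
rewrite !big_cons shiftM IHs; congr (_ * _).
by rewrite /shift comp_polyB comp_polyX comp_polyC polyCB; ring.
Qed.

(** * Heights of vertices under the relation between [alpha] and [beta] *)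

Variables (m n : nat).
Hypotheses (alpha_neq0 : alpha != 0) (m_gt0 : (0 < m)%N) (n_gt0 : (0 < n)%N).
Hypotheses (coprime_mn : coprime m n) (rel_mn : m%:R * alpha + n%:R * beta = 0).

Let mulnb : n%:R * beta = - (m%:R * alpha).
Proof. by apply/eqP; rewrite -addr_eq0 addrC rel_mn. Qed.

(** The coefficient of [alpha] is minus the height m y - n x, so a vertex determines its height. *)
Lemma vertexE lambda v :
  n%:R * (vertex lambda v - lambda) = ((n * v.1)%:R - (m * v.2)%:R) * alpha.
Proof.
transitivity (v.1%:R * n%:R * alpha + v.2%:R * (n%:R * beta)).
  by rewrite /vertex; ring.
by rewrite mulnb !natrM; ring.
Qed.

Lemma vertex_eq lambda v w : vertex lambda v = vertex lambda w ->
  (n * v.1 + m * w.2 = n * w.1 + m * v.2)%N.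
Proof.
move=> eq_vw; have := vertexE lambda v; rewrite eq_vw vertexE.
move/(mulIf alpha_neq0)/eqP.
by rewrite subr_eq addrAC eq_sym subr_eq -!natrD eqr_nat => /eqP.
Qed.

Lemma vertex_cycle lambda : vertex lambda (m, n) = lambda.
Proof. by rewrite /vertex /= -addrA rel_mn addr0. Qed.

(** * The closed walk of a Dyck path *)

Section DyckPath.

Variables (pi : seq (nat * nat)) (lambda : R[i]).
Hypothesis Dpi : pi \in Dyck m n.

Local Notation p := (path_poly alpha beta m n 1 pi lambda).
Local Notation q := (path_poly alpha beta m n 2 pi lambda).

(** The strict bounds exclude just the pair 0, [m + n], where the walk closes up. Equal heights make
    [m * (j - i)] a multiple of [m + n], which is coprime to [m], so [m + n] divides [j - i]. *)
Lemma Dyck_vertex_inj (i j : nat) : (i <= m + n)%N -> (j <= m + n)%N ->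
  (i < j + (m + n))%N -> (j < i + (m + n))%N ->
  vertex lambda (pt pi i) = vertex lambda (pt pi j) -> i = j.
Proof.
wlog le_ij : i j / (i <= j)%N.
  by case/orP: (leq_total i j) => le_ij wlg *; [|symmetry]; apply: wlg.
move=> i_le j_le _ lt_ji /vertex_eq.
have := Dyck_height Dpi i_le; have := Dyck_height Dpi j_le.
case: (pt pi i) (pt pi j) => [x y] [x' y'] /= sj si eq_xy.
have /dvdnP dvdN : (exists k, m * (j - i) = k * (m + n))%N.
  exists (x' - x)%N; rewrite -sj -si; nia.
rewrite Gauss_dvdr in dvdN; last by rewrite coprime_sym /coprime gcdnDl.
have : (j - i == 0)%N by apply: contraTT dvdN; rewrite -lt0n => /gtnNdvd->//; lia.
by lia.
Qed.

Lemma vertex_start : vertex lambda (pt pi 0) = lambda.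
Proof. by case/DyckP: Dpi => _ -> *; rewrite vertex00. Qed.

Lemma vertex_end : vertex lambda (pt pi (m + n)) = lambda.
Proof. by case/DyckP: Dpi => _ _ -> *; rewrite vertex_cycle. Qed.

Lemma vertex_pred (i : nat) : (0 < i <= m + n)%N ->
  vertex lambda (pt pi i.-1) = vertex lambda (pt pi i)
    - (if (pt pi i).1 == (pt pi i.-1).1 then beta else alpha).
Proof.
case: i => // i /= i_lt; case/DyckP: Dpi => _ _ _ /(_ i i_lt) + _.
case: (pt pi i) => x y /orP[] /eqP-> /=.
  by rewrite eqn_leq ltnn vertex_right addrK.
by rewrite eqxx vertex_up addrK.
Qed.

(** Shifting moves each root back to the preceding vertex, so the two sides list the vertices of a
    closed walk from index 1 and from index 0. *)
Lemma path_solution : solution alpha beta (path_pair alpha beta m n pi lambda).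
Proof.
pose up i := (pt pi i).1 == (pt pi i.-1).1.
transitivity (\prod_(1 <= i < (m + n).+1) ('X - (vertex lambda (pt pi i.-1))%:P)).
  rewrite /= path_polyM // !big_add1 /=; move: vertex_end vertex_start.
  case: (m + n)%N => [|N] vN v0; first by rewrite !big_geq.
  by rewrite big_nat_recr //= [RHS]big_nat_recl //= vN v0 mulrC.
rewrite /= path_poly1E path_poly2E !shift_prod_XsubC !big_map !big_filter.
rewrite (bigID up) /=; congr (_ * _); rewrite big_seq_cond [RHS]big_seq_cond.
  apply: eq_bigr => i /andP[]; rewrite mem_index_iota ltnS => /vertex_pred-> upi.
  by rewrite -/(up i) upi.
apply: eq_big => [i|i /andP[]].
  case: (boolP (i \in _)) => //=; rewrite mem_index_iota ltnS => i_in.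
  by rewrite /up (Dyck_step Dpi i_in) negbK.
by rewrite mem_index_iota ltnS => /vertex_pred-> /negPf upi; rewrite -/(up i) upi.
Qed.

Lemma root_path2P (z : R[i]) : reflect
  (exists i, [/\ (i < m + n)%N, pt pi i.+1 = ((pt pi i).1.+1, (pt pi i).2)
               & z = vertex lambda (pt pi i) + alpha])
  (root q z).
Proof.
rewrite path_poly2E root_prod_XsubC.
case/DyckP: Dpi => _ _ _ stepP _; apply: (iffP mapP) => [[[|i]]|[i [i_lt ptE ->]]].
- by rewrite mem_filter mem_index_iota andbF.
- rewrite mem_filter mem_index_iota ltnS => /andP[/= right_i i_lt] ->.
  exists i; case/orP: (stepP i i_lt) right_i => /eqP-> /=; last by rewrite eqn_leq ltnn.
  by move=> _; split=> //; case: (pt pi i) => x y; rewrite vertex_right.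
- exists i.+1; first by rewrite mem_filter mem_index_iota /= ltnS i_lt ptE /= eqxx.
  by rewrite ptE; case: (pt pi i) => x y; rewrite vertex_right.
Qed.

(** A root of [q] one [alpha] past vertex [i] comes from a right step at some vertex [j] with the
    same value; injectivity gives [i = j]. So the greedy rule goes right exactly when [pi] does. *)
Lemma Dyck_greedy : pi = traject (greedy_step q lambda) (0%N, 0%N) (m + n).+1.
Proof.
have [sizeE pt0 _ stepP _] := DyckP _ _ _ Dpi.
apply: (@eq_from_nth _ (0%N, 0%N)) => [|i]; rewrite ?size_traject // sizeE.
elim: i => [|i IHi] i_lt; first by rewrite pt0.
move: (IHi (ltnW i_lt)); rewrite !nth_traject ?(ltnW i_lt) // iterS => <-.
rewrite ltnS in i_lt; rewrite /greedy_step.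
case: root_path2P => [[j [j_lt ptj /addIr]]|noright].
  move/(Dyck_vertex_inj (ltnW i_lt) (ltnW j_lt)) => eq_ij.
  by rewrite eq_ij //; lia.
case/orP: (stepP i i_lt) => /eqP // ptE; case: noright.
by exists i; split=> //.
Qed.

End DyckPath.

(** * Uniqueness of the path and its base point *)

Lemma path_pair_shift (pi pi' : seq (nat * nat)) lambda lambda' :
    pi \in Dyck m n -> pi' \in Dyck m n ->
    path_pair alpha beta m n pi lambda = path_pair alpha beta m n pi' lambda' ->
  exists a : nat, n%:R * (lambda' - lambda) = - a%:R * alpha.
Proof.
move=> Dpi Dpi' [eq_p eq_q].
have : root (\prod_(z <- [seq vertex lambda' (pt pi' i) | i <- index_iota 1 (m + n).+1])
            ('X - z%:P)) lambda'.
  (* The product starts at index 1, so [lambda'] is found as the end vertex. *)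
  rewrite root_prod_XsubC; apply/mapP; exists (m + n)%N; last by rewrite vertex_end.
  by rewrite mem_index_iota ltnSn addn_gt0 m_gt0.
rewrite big_map -path_polyM // -eq_p -eq_q path_polyM //.
rewrite -(big_map _ xpredT (fun z => 'X - z%:P)).
rewrite root_prod_XsubC => /mapP[i + ->]; rewrite mem_index_iota ltnS => /andP[_ i_le].
rewrite vertexE; case/DyckP: Dpi => _ _ _ _ /(_ i i_le) above.
exists (m * (pt pi i).2 - n * (pt pi i).1)%N.
by rewrite natrB // opprB.
Qed.

(** Each base point is a vertex of the other walk, hence at height at least 0 relative to the other;
    the two heights are opposite, so both vanish. Then both paths are the same greedy walk. *)
Lemma path_pair_inj (pi pi' : seq (nat * nat)) lambda lambda' :
    pi \in Dyck m n -> pi' \in Dyck m n ->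
    path_pair alpha beta m n pi lambda = path_pair alpha beta m n pi' lambda' ->
  (pi, lambda) = (pi', lambda').
Proof.
move=> Dpi Dpi' eq_pair.
have [a aE] := path_pair_shift Dpi Dpi' eq_pair.
have [b bE] := path_pair_shift Dpi' Dpi (esym eq_pair).
have : (a + b)%:R * alpha = 0.
  rewrite -[LHS]opprK -mulNr natrD opprD mulrDl -aE -bE; ring.
move/eqP; rewrite mulf_eq0 (negPf alpha_neq0) orbF pnatr_eq0 addn_eq0.
case/andP=> /eqP a0 _; move: aE; rewrite a0 oppr0 mul0r => /eqP.
rewrite mulf_eq0 pnatr_eq0 -[n == _]negbK -lt0n n_gt0 subr_eq0 => /eqP eq_l.
congr (_, _) => //; rewrite (Dyck_greedy lambda Dpi) (Dyck_greedy lambda' Dpi').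
by case: eq_pair => _ ->; rewrite eq_l.
Qed.

(** * The greedy walk in the graph of a solution *)

Section Greedy.

Variables (p q : {poly R[i]}).
Hypothesis sol : solution alpha beta (p, q).

Let V (z : R[i]) := root (p * q) z.

Variable lambda : R[i].
Hypothesis V_lambda : V lambda.
Hypothesis lambda_max : forall z, V z -> ~~ (lambda / alpha < z / alpha).

(** Such a [z] would have height [- j], and z / alpha would exceed lambda / alpha by j / n. *)
Let V_above (z : R[i]) (j : nat) : V z -> (0 < j)%N ->
  n%:R * (z - lambda) <> j%:R * alpha.
Proof.
move=> Vz j_gt0 zE; have /negP[] := lambda_max Vz.
rewrite -subr_gt0 -mulrBl -(pmulr_rgt0 _ (_ : 0 < n%:R)) ?ltr0n // mulrA zE.
by rewrite mulfK // ltr0n.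
Qed.

(* Adding [alpha - beta] lowers the height by [m + n], so [lowest v] says that
   [v] has minimal height among the roots in its residue class. *)
Let lowest v := V (vertex lambda v) /\
  forall k, (0 < k)%N -> ~~ V (vertex lambda v + k%:R * (alpha - beta)).

Lemma lowest_start : lowest (0%N, 0%N).
Proof.
split=> [|k k_gt0]; rewrite vertex00 //.
apply/negP => /(V_above (j := (k * (m + n))%N)); apply.
  by rewrite muln_gt0 k_gt0 addn_gt0 m_gt0.
(* By the relation, n (alpha - beta) = (m + n) alpha, so this root would lie at height - k (m +
   n). *)
transitivity (k%:R * (n%:R * alpha - n%:R * beta)); first by ring.
by rewrite mulnb natrM natrD; ring.
Qed.

(** A lower root in the residue class of the new vertex has a predecessor that is a root, and this
    would lie below [v] in the class of [v]. The one case where it could be [v] itself is excluded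
    by the preference for right steps. *)
Lemma lowest_step v : lowest v -> lowest (greedy_step q lambda v).
Proof.
case: v => x y [Vv lowv].
have Vpred z := solution_pred (z := z) sol.
rewrite /greedy_step; case: (boolP (root q _)) => [right_v|nright_v] /=.
  rewrite /lowest vertex_right; split=> [|k k_gt0].
    by rewrite /V rootM right_v orbT.
  apply/negP => /Vpred/orP[]/andP[_]; apply/negP.
    by rewrite addrAC addrK lowv.
  have := lowv k.+1 isT; congr (~~ V _).
  by rewrite -natr1; ring.
have up_v : root p (vertex lambda (x, y) + beta).
  by move: Vv; rewrite /V (solution_succ _ sol) (negPf nright_v) orbF.
rewrite /lowest vertex_up; split=> [|k k_gt0].
  by rewrite /V rootM up_v.
apply/negP => /Vpred/orP[]/andP[]; last first.
  by move=> _; apply/negP; rewrite addrAC addrK lowv.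
case: k k_gt0 => [//|[_|k _ _]].
  by rewrite mul1r addrAC -addrA subrK (negPf nright_v).
apply/negP; have := lowv k.+1 isT; congr (~~ V _).
by rewrite -[k.+2%:R]natr1; ring.
Qed.

Let g := traject (greedy_step q lambda) (0%N, 0%N) (m + n).+1.

Let g_step (i : nat) : (i < m + n)%N -> pt g i.+1 = greedy_step q lambda (pt g i).
Proof. by move=> i_lt; rewrite !nth_traject ?ltnS ?(ltnW i_lt). Qed.

Let g_lowest (i : nat) : (i <= m + n)%N -> lowest (pt g i).
Proof.
elim: i => [_|i IHi i_lt]; first exact: lowest_start.
by rewrite g_step //; apply/lowest_step/IHi/ltnW.
Qed.

Lemma greedy_Dyck : g \in Dyck m n.
Proof.
have above i : (i <= m + n)%N -> (n * (pt g i).1 <= m * (pt g i).2)%N.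
  move=> /g_lowest[Vgi _]; rewrite leqNgt; apply/negP => below.
  apply: (V_above Vgi (j := n * (pt g i).1 - m * (pt g i).2)).
    by rewrite subn_gt0.
  by rewrite vertexE natrB // ltnW.
have unit_g i : (i < m + n)%N -> unit_step (pt g i) (pt g i.+1).
  by move=> /g_step->; rewrite /greedy_step /unit_step; case: ifP; rewrite eqxx ?orbT.
have height i : (i <= m + n)%N -> ((pt g i).1 + (pt g i).2 = i)%N.
  elim: i => [|i IHi] // i_lt.
  by rewrite (unit_step_height (unit_g i i_lt)) IHi // ltnW.
apply/DyckP; split=> //; first by rewrite size_traject.
have := height _ (leqnn _); have := above _ (leqnn _); have := g_lowest (leqnn _).
case: (pt g (m + n)) => x y [_ low] /= le_xy sum_xy.
have le_xm : (x <= m)%N by nia.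
(* If [x < m], moving the end point down its residue class by [m - x] reaches [(m, n)], whose vertex
   is the root [lambda]; this contradicts [lowest]. *)
have eq_xm : (m - x)%N = 0%N.
  apply/eqP; rewrite -leqn0 leqNgt; apply/negP => /low.
  rewrite vertex_antidiag; last by lia.
  have -> : (x + (m - x) = m)%N by lia.
  have -> : (y - (m - x) = n)%N by lia.
  by rewrite vertex_cycle V_lambda.
by congr (_, _); lia.
Qed.

(** The vertices are distinct, so it suffices that each linear factor vanishes at a root of [p] or
    [q]. An up step is taken only when the right edge is missing, and then the up edge must
    exist. *)
Lemma greedy_dvdp : (path_poly alpha beta m n 1 g lambda %| p)
  && (path_poly alpha beta m n 2 g lambda %| q).
Proof.
have Dg := greedy_Dyck.
have uniq_vertices (a : pred nat) :
    uniq [seq vertex lambda (pt g i) | i <- index_iota 1 (m + n).+1 & a i].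
  rewrite map_inj_in_uniq ?filter_uniq ?iota_uniq // => i j.
  rewrite !mem_filter !mem_index_iota => /andP[_ i_in] /andP[_ j_in].
  by apply: (Dyck_vertex_inj Dg); lia.
have root_p i : (i < m + n)%N -> (pt g i.+1).1 == (pt g i).1 ->
    root p (vertex lambda (pt g i.+1)).
  move=> i_lt; rewrite g_step //; case: (pt g i) (g_lowest (ltnW i_lt)) => x y [+ _].
  rewrite /V (solution_succ _ sol) /greedy_step; case: ifP => /= _.
    by rewrite eqn_leq ltnn.
  by rewrite vertex_up orbF.
have root_q i : (i < m + n)%N -> (pt g i.+1).2 == (pt g i).2 ->
    root q (vertex lambda (pt g i.+1)).
  move=> i_lt; rewrite g_step //; case: (pt g i) => x y.
  rewrite /greedy_step; case: ifP => /= [|_]; first by rewrite vertex_right.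
  by rewrite eqn_leq ltnn.
rewrite path_poly1E path_poly2E; apply/andP; split;
  (apply: uniq_roots_dvdp; last by rewrite uniq_rootsE);
  apply/allP=> z /mapP[[|i]]; rewrite mem_filter mem_index_iota ?andbF //;
  rewrite ltnS => /andP[/= ? ?] ->; [exact: root_p | exact: root_q].
Qed.

End Greedy.

(** * Divisibility by path pairs, and irreducibility *)

Lemma path_dvdp p q : solution alpha beta (p, q) -> p * q != 0 ->
    size (p * q) != 1%N ->
  exists pi lambda, [/\ pi \in Dyck m n,
    path_poly alpha beta m n 1 pi lambda %| p
  & path_poly alpha beta m n 2 pi lambda %| q].
Proof.
move=> sol pq_neq0 size_neq1.
have [s sE] := closed_field_poly_normal (p * q).
have rootE z : root (p * q) z = (z \in s).
  by rewrite sE rootZ ?lead_coef_eq0 // root_prod_XsubC.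
have s_neq0 : s != [::].
  apply: contra size_neq1 => /eqP s0.
  by rewrite sE s0 big_nil size_scale ?lead_coef_eq0 // size_poly1.
(* Minimal height means maximal z / alpha. *)
have [lambda s_lambda lambda_max] := exists_maximal (fun z => z / alpha) s_neq0.
have V_lambda : root (p * q) lambda by rewrite rootE.
have lambda_top z : root (p * q) z -> ~~ (lambda / alpha < z / alpha).
  by rewrite rootE; apply: lambda_max.
exists (traject (greedy_step q lambda) (0%N, 0%N) (m + n).+1), lambda.
have /andP[? ?] := greedy_dvdp sol V_lambda lambda_top.
by split=> //; apply: (greedy_Dyck sol V_lambda lambda_top).
Qed.

Lemma size_path_polyM (pi : seq (nat * nat)) lambda : pi \in Dyck m n ->
  size (path_poly alpha beta m n 1 pi lambda
        * path_poly alpha beta m n 2 pi lambda) = (m + n).+1.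
Proof. by move=> Dpi; rewrite path_polyM // size_prod_XsubC size_iota subn1. Qed.

Lemma size_solution p q : solution alpha beta (p, q) -> p * q != 0 ->
  size (p * q) != 1%N -> (m + n < size (p * q)%R)%N.
Proof.
move=> sol pq_neq0 /(path_dvdp sol pq_neq0)[pi [lambda [Dpi p1 q1]]].
by rewrite -(size_path_polyM lambda Dpi); apply: dvdp_leq => //; apply: dvdp_mul.
Qed.

(** Two non-constant factors would each have total degree at least [m + n], while the path pair has
    total degree exactly [m + n]. *)
Lemma path_irreducible (pi : seq (nat * nat)) lambda : pi \in Dyck m n ->
  irreducible_solution alpha beta (path_pair alpha beta m n pi lambda).
Proof.
move=> Dpi; have sizeE := size_path_polyM lambda Dpi.
split; [exact: path_solution | | by split; apply: path_monic |].
  by case=> p1 q1; move: sizeE; rewrite p1 q1 mulr1 size_poly1 => -[]; lia.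
move=> [p1 q1] [p2 q2] sol1 sol2 [/= pE qE].
move: sizeE; rewrite pE qE mulrACA => sizeE.
have : p1 * q1 * (p2 * q2) != 0 by rewrite -size_poly_eq0 sizeE.
rewrite mulf_eq0 negb_or => /andP[neq1 neq2].
have [size1|/(size_solution sol1 neq1) le1] := eqVneq (size (p1 * q1)) 1%N.
  by left; apply/constant_polyM => //; apply/eqP.
have [size2|/(size_solution sol2 neq2) le2] := eqVneq (size (p2 * q2)) 1%N.
  by right; apply/constant_polyM => //; apply/eqP.
have arith a b c :
  (a + b).-1 = c.+1 -> (c < a)%N -> (c < b)%N -> (0 < c)%N -> False by lia.
by rewrite size_mul // in sizeE; case: (arith _ _ _ sizeE le1 le2); lia.
Qed.

Lemma irreducible_path pq : irreducible_solution alpha beta pq ->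
  exists pi lambda, pi \in Dyck m n /\ pq = path_pair alpha beta m n pi lambda.
Proof.
case: pq => p q [sol neq1 [/= p_monic q_monic] irr].
have pq_neq0 : p * q != 0 by rewrite mulf_neq0 ?monic_neq0.
have [/eqP/(constant_polyM pq_neq0)[p_cst q_cst]|size_neq1] := eqVneq (size (p * q)) 1%N.
  by case: neq1; rewrite (monic_constant p_monic p_cst) (monic_constant q_monic q_cst).
have [pi [lambda [Dpi /dvdpP[r pE] /dvdpP[t qE]]]] := path_dvdp sol pq_neq0 size_neq1.
have pqE : (p, q) = path_pair alpha beta m n pi lambda * (r, t).
  by rewrite pE qE [r * _]mulrC [t * _]mulrC.
have path_neq0 : (path_pair alpha beta m n pi lambda).1
    * (path_pair alpha beta m n pi lambda).2 != 0.
  by rewrite -size_poly_eq0 size_path_polyM.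
have sol' : solution alpha beta (r, t).
  by apply: (solutionM (path_solution lambda Dpi) path_neq0); rewrite -pqE.
exists pi, lambda; split=> //.
(* The path pair is not constant, so the cofactor is; being monic, it is trivial. *)
have [/(constant_polyM path_neq0)|[/= r_cst t_cst]] :=
  irr _ _ (path_solution lambda Dpi) sol' pqE.
  by rewrite size_path_polyM // eqSS addn_eq0 -[m == _]negbK -lt0n m_gt0.
move: p_monic q_monic; rewrite pE qE !monicMr ?path_monic // => r_monic t_monic.
by rewrite (monic_constant r_monic r_cst) (monic_constant t_monic t_cst) !mul1r.
Qed.

End Solutions.

Theorem theorem4p12 (R : realType) (alpha beta : R[i]) (m n : nat)
    (alpha_neq0 : alpha <> 0) (beta_neq0 : beta <> 0)
    (m_gt0 : (0 < m)%N) (n_gt0 : (0 < n)%N) (coprime_mn : coprime m n)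
    (rel_mn : m%:R * alpha + n%:R * beta = 0) :
  (forall (pi : seq (nat * nat)) (lambda : R[i]), pi \in Dyck m n ->
     irreducible_solution alpha beta (path_pair alpha beta m n pi lambda)) /\
  (forall pq : {poly R[i]} * {poly R[i]}, irreducible_solution alpha beta pq ->
     exists! pl : seq (nat * nat) * R[i],
       pl.1 \in Dyck m n /\ pq = path_pair alpha beta m n pl.1 pl.2).
Proof.
have alpha_neq0' : alpha != 0 by apply/eqP.
split=> [pi lambda Dpi|pq]; first exact: path_irreducible.
case/(irreducible_path alpha_neq0' m_gt0 n_gt0 coprime_mn rel_mn).
move=> pi [lambda [Dpi pqE]].
exists (pi, lambda); split=> // -[pi' lambda'] [/= Dpi' pqE'].
exact: (path_pair_inj alpha_neq0' m_gt0 n_gt0 coprime_mn rel_mn Dpi Dpi'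
  (etrans (esym pqE) pqE')).
Qed.
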